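(* Let $\sigma$ be a partition of the set of all primes, $\tau$ a subgroup functor and $n$ a non-negative integer. The collection $l^{\tau}_{\sigma_n}$ of all $\tau$-closed $n$-multiply $\sigma$-local formations is partially ordered with respect to inclusion. Moreover, $l^{\tau}_{\sigma_n}$ is a complete lattice of formations in which, for any set $\{\mathfrak{F}_j\mid j\in J\}\subseteq l^{\tau}_{\sigma_n}$, the intersection $\bigcap_{j\in J}\mathfrak{F}_j$ is the greatest lower bound and $\vee^{\tau}_{\sigma_n}(\mathfrak{F}_j\mid j\in J)$ is the least upper bound of $\{\mathfrak{F}_j\mid j\in J\}$ in $l^{\tau}_{\sigma_n}$.
   Context: All groups are finite; classes of groups are closed under isomorphism. $\sigma=\{\sigma_i\mid i\in I\}$ is a partition of the set $\mathbb{P}$ of all primes; $\pi(G)$ is the set of primes dividing $|G|$; $\sigma(G)=\{\sigma_i\mid \sigma_i\cap\pi(G)\neq\emptyset\}$ and $\sigma(\mathfrak{X})=\bigcup_{G\in\mathfrak{X}}\sigma(G)$ for a class of groups $\mathfrak X$. $\sigma_i'=\mathbb{P}\setminus\sigma_i$; $O_{\sigma_i}(G)$, $O_{\sigma_i'}(G)$ are the largest normal $\sigma_i$-subgroup and $\sigma_i'$-subgroup of $G$; $F_{\{\sigma_i\}}(G)=O_{\sigma_i',\sigma_i}(G)$ is defined by $O_{\sigma_i',\sigma_i}(G)/O_{\sigma_i'}(G)=O_{\sigma_i}(G/O_{\sigma_i'}(G))$. A formation is a class of groups $\mathfrak F$ such that $G\in\mathfrak F$ implies $G/N\in\mathfrak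 F$, and $G/N,G/R\in\mathfrak F$ implies $G/(N\cap R)\in\mathfrak F$. A formation $\sigma$-function is a function $f:\sigma\to\{\text{formations of groups}\}$ (the value $\emptyset$ is allowed); $LF_\sigma(f)$ is the class of all $G$ such that $G=1$, or $G\ne1$ and $G/F_{\{\sigma_i\}}(G)\in f(\sigma_i)$ for all $\sigma_i\in\sigma(G)$. Every formation is $0$-multiply $\sigma$-local; for $n>0$ a formation $\mathfrak F$ is $n$-multiply $\sigma$-local if either $\mathfrak F=(1)$ (the class of identity groups) or $\mathfrak F=LF_\sigma(f)$ where $f(\sigma_i)$ is $(n-1)$-multiply $\sigma$-local for all $\sigma_i\in\sigma(\mathfrak F)$. A subgroup functor $\tau$ assigns to each group $G$ a set $\tau(G)$ of subgroups of $G$ with $G\in\tau(G)$ such that for every epimorphism $\varphi:A\to B$ and all $H\in\tau(A)$, $T\in\tau(B)$ we have $H^{\varphi}\in\tau(B)$ and $T^{\varphi^{-1}}\in\tau(A)$. A class $\mathfrak F$ is $\tau$-closed if $\tau(G)\subseteq\mathfrak F$ for all $G\in\mathfrak F$. For a set (class) of groups $\mathfrak X$, $l^{\tau}_{\sigma_n}\mathrm{form}(\mathfrak X)$ is the intersection of all $\tau$-closed $n$-multiply $\sigma$-local formations containing $\mathfrak X$, and $\vee^{\tau}_{\sigma_n}(\mathfrak F_j\mid j\in J)=l^{\tau}_{\sigma_n}\mathrm{form}(\bigcup_{j\in J}\mathfrak F_j)$. A nonempty collection $\theta$ of formations is a complete lattice of formations if the intersection of any set of formations from $\theta$ belongs to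 $\theta$ and $\theta$ contains a formation $\mathfrak F$ with $\mathfrak H\subseteq\mathfrak F$ for all $\mathfrak H\in\theta$. *)

(* Defs.v *)
From mathcomp Require Import all_boot all_fingroup all_solvable.
From mathcomp Require Import boolp classical_sets.

Set Implicit Arguments.
Unset Strict Implicit.
Unset Printing Implicit Defensive.

Local Open Scope group_scope.

(* An arbitrary finite group, as a subgroup of some finGroupType. *)
Record fingrp := FinGrp { fingrp_type : finGroupType;
                          fingrp_group :> {group fingrp_type} }.

(* Classes of groups, and collections of such classes, are plain predicates:
   the library type [set T] does not admit finGroupType-sized types T, for
   universe reasons. *)
Definition grpclass := fingrp -> Prop.

Definition subclass (X Y : grpclass) : Prop := forall G, X G -> Y G.
Local Notation "X `<=` Y" := (subclass X Y) : group_scope.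

Definition class_bigcap (J : Type) (F : J -> grpclass) : grpclass :=
  fun G => forall j, F j G.

Definition class_bigcup (J : Type) (F : J -> grpclass) : grpclass :=
  fun G => exists j, F j G.

Definition class_meet (S : grpclass -> Prop) : grpclass :=
  fun G => forall F, S F -> F G.

Definition isog_closed (X : grpclass) : Prop :=
  forall G H : fingrp, G \isog H -> X G -> X H.

Definition trivial_class : grpclass := fun G => G :=: 1.

(* A formation may be empty. *)
Record formation (F : grpclass) : Prop := Formation {
  formation_isog : isog_closed F;
  formation_quotient : forall (gT : finGroupType) (G N : {group gT}),
    N <| G -> F (FinGrp G) -> F (FinGrp (G / N));
  formation_residual : forall (gT : finGroupType) (G N R : {group gT}),
    N <| G -> R <| G -> F (FinGrp (G / N)) -> F (FinGrp (G / R)) ->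
    F (FinGrp (G / (N :&: R))) }.

(* The blocks are indexed injectively by I, since they are nonempty and
   pairwise disjoint; functions on the set of blocks are functions on I. *)
Definition prime_partition (I : Type) (sigma : I -> nat_pred) : Prop :=
  (partition [set: I] (fun i => [set p | p \in sigma i])
     [set p | prime p])%classic.

Section SigmaLocal.

Variables (I : Type) (sigma : I -> nat_pred).

Definition sigma_of (G : fingrp) (i : I) : Prop :=
  exists2 p, p \in \pi(#|G|) & p \in sigma i.

Definition sigma_of_class (X : grpclass) (i : I) : Prop :=
  exists2 G, X G & sigma_of G i.

Definition Fsigma (gT : finGroupType) (i : I) (G : {group gT}) : {group gT} :=
  'O_{(sigma i)^', sigma i}(G).

Definition LF (f : I -> grpclass) : grpclass :=
  fun G => G :=: 1 \/ (G :!=: 1 /\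
    forall i, sigma_of G i -> f i (FinGrp (G / Fsigma i G))).

Fixpoint multiply_sigma_local (n : nat) (F : grpclass) : Prop :=
  if n isn't n'.+1 then formation F else
  formation F /\
  (F = trivial_class \/
   exists f : I -> grpclass,
     [/\ forall i, formation (f i), F = LF f &
         forall i, sigma_of_class F i -> multiply_sigma_local n' (f i)]).

End SigmaLocal.

Definition group_subsets := forall gT : finGroupType,
  {group gT} -> {set {group gT}}.

Record subgroup_functor (tau : group_subsets) : Prop := SubgroupFunctor {
  subgroup_functor_sub : forall (gT : finGroupType) (G H : {group gT}),
    H \in tau gT G -> H \subset G;
  subgroup_functor_refl : forall (gT : finGroupType) (G : {group gT}),
    G \in tau gT G;
  subgroup_functor_morphim : forall (aT rT : finGroupType) (A : {group aT})
    (B : {group rT}) (phi : {morphism A >-> rT}) (H : {group aT}),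
    phi @* A = B -> H \in tau aT A -> (phi @* H)%G \in tau rT B;
  subgroup_functor_morphpre : forall (aT rT : finGroupType) (A : {group aT})
    (B : {group rT}) (phi : {morphism A >-> rT}) (T : {group rT}),
    phi @* A = B -> T \in tau rT B -> (phi @*^-1 T)%G \in tau aT A }.

Definition functor_closed (tau : group_subsets) (F : grpclass) : Prop :=
  forall (gT : finGroupType) (G H : {group gT}),
    F (FinGrp G) -> H \in tau gT G -> F (FinGrp H).

Definition l_tau_sigma (I : Type) (sigma : I -> nat_pred)
    (tau : group_subsets) (n : nat) : grpclass -> Prop :=
  fun F => multiply_sigma_local sigma n F /\ functor_closed tau F.

Definition l_tau_sigma_form (I : Type) (sigma : I -> nat_pred)
    (tau : group_subsets) (n : nat) (X : grpclass) : grpclass :=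
  class_meet (fun F => l_tau_sigma sigma tau n F /\ X `<=` F).

Definition join_tau_sigma (I : Type) (sigma : I -> nat_pred)
    (tau : group_subsets) (n : nat) (J : Type) (F : J -> grpclass) :
    grpclass :=
  l_tau_sigma_form sigma tau n (class_bigcup F).

Definition inclusion_partial_order (theta : grpclass -> Prop) : Prop :=
  [/\ forall F, theta F -> F `<=` F,
      forall F H, theta F -> theta H -> F `<=` H -> H `<=` F -> F = H &
      forall F H K, theta F -> theta H -> theta K ->
        F `<=` H -> H `<=` K -> F `<=` K].

(* S may be empty; its intersection is then the class of all groups. *)
Record complete_lattice_of_formations (theta : grpclass -> Prop) : Prop :=
  CompleteLatticeOfFormations {
    clf_nonempty : exists F, theta F;
    clf_formation : forall F, theta F -> formation F;
    clf_bigcap : forall S : grpclass -> Prop,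
      (forall F, S F -> theta F) -> theta (class_meet S);
    clf_top : exists2 F, theta F & forall H, theta H -> H `<=` F }.

Definition greatest_lower_bound (theta : grpclass -> Prop) (J : Type)
    (F : J -> grpclass) (M : grpclass) : Prop :=
  [/\ theta M, forall j, M `<=` F j &
      forall H, theta H -> (forall j, H `<=` F j) -> H `<=` M].

Definition least_upper_bound (theta : grpclass -> Prop) (J : Type)
    (F : J -> grpclass) (M : grpclass) : Prop :=
  [/\ theta M, forall j, F j `<=` M &
      forall H, theta H -> (forall j, F j `<=` H) -> M `<=` H].

(* Main.v *)
Require Import Defs.
From mathcomp Require Import all_boot all_fingroup all_solvable.
From mathcomp Require Import boolp classical_sets.

(** The point is that $n$-multiply $\sigma$-local formations are stable under
    arbitrary intersections; all the lattice assertions then follow formally.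

    The operator [LF] is defined by a condition quantified over all $i$, so it commutes
    with intersections: a group lies in every [LF (h k)] exactly when it lies
    in [LF] of the pointwise intersection of the [h k].  Hence, if every member
    of a collection $S$ is of the form [LF h] with suitable values [h i], the
    intersection of $S$ is [LF] of the pointwise intersection of these [h]
    ([class_meet_LF]).  A block $i$ met by some group of the intersection is
    met by that same group in every member of $S$, so all the values at $i$
    entering the intersection are $(n-1)$-multiply $\sigma$-local, and
    induction on $n$ applies ([multiply_sigma_local_meet]).  The one other
    case, in which the class of identity groups belongs to $S$, is immediate:
    for $n > 0$ every member of $S$ contains the identity groups, so the
    intersection is the class of identity groups.

    The empty intersection, the class of all groups, is covered by the same
    argument and provides the top element.  Joins are intersections of upper
    bounds, hence belong to the collection as well. *)

Set Implicit Arguments.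
Unset Strict Implicit.
Unset Printing Implicit Defensive.

Local Open Scope group_scope.

Lemma subclass_antisym (X Y : grpclass) :
  subclass X Y -> subclass Y X -> X = Y.
Proof.
by move=> XY YX; apply: funext => G; apply/propext; split=> [/XY|/YX].
Qed.

Lemma class_bigcapE (J : Type) (F : J -> grpclass) :
  class_bigcap F = class_meet (fun X => exists j, X = F j).
Proof.
apply: subclass_antisym => G FG; first by move=> _ [j ->].
by move=> j; apply: FG; exists j.
Qed.

Lemma formation_meet (S : grpclass -> Prop) :
  (forall F, S F -> formation F) -> formation (class_meet S).
Proof.
move=> formS; split.
- by move=> G H isoGH SG F SF; apply: (formation_isog (formS F SF) isoGH (SG F SF)).
- move=> gT G N nNG SG F SF.
  exact: (formation_quotient (formS F SF) nNG (SG F SF)).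
- move=> gT G N R nNG nRG SN SR F SF.
  exact: (formation_residual (formS F SF) nNG nRG (SN F SF) (SR F SF)).
Qed.

Lemma functor_closed_meet (tau : group_subsets) (S : grpclass -> Prop) :
  (forall F, S F -> functor_closed tau F) -> functor_closed tau (class_meet S).
Proof. by move=> tauS gT G H SG tauH F SF; apply: tauS (SG F SF) tauH. Qed.

Section SigmaLocalMeet.

Variables (I : Type) (sigma : I -> nat_pred).

Lemma multiply_sigma_local_formation n F :
  multiply_sigma_local sigma n F -> formation F.
Proof. by case: n => [|n] // []. Qed.

Lemma trivial_sub_multiply_sigma_local n F :
  multiply_sigma_local sigma n.+1 F -> subclass trivial_class F.
Proof. by case=> _ [->//|[f [_ -> _]]] G G1; left. Qed.

(** The family may consist of all pairs of a class and one of its possible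
    definitions by a $\sigma$-function: keeping every definition, rather than
    selecting one, does not change the intersection. *)
Lemma class_meet_LF (S : grpclass -> Prop)
    (W : grpclass -> (I -> grpclass) -> Prop) :
  (forall F h, W F h -> F = LF sigma h) ->
  (forall F, S F -> exists h, W F h) ->
  class_meet S =
  LF sigma (fun i => class_meet (fun X => exists F h,
    [/\ S F, W F h & X = h i])).
Proof.
move=> WLF exW; apply: subclass_antisym => G SG.
  have [G1|ntG] := eqVneq (G : {set _}) 1; first by left.
  right; split=> // i siG _ [F [h [SF WFh ->]]].
  move: (SG F SF); rewrite (WLF _ _ WFh) => -[G1|[_]]; last exact.
  by rewrite G1 eqxx in ntG.
move=> F SF; have [h WFh] := exW F SF.
rewrite (WLF _ _ WFh); case: SG => [G1|[ntG fG]]; [by left | right].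
by split=> // i siG; apply: (fG i siG); exists F, h.
Qed.

Lemma multiply_sigma_local_meet n (S : grpclass -> Prop) :
  (forall F, S F -> multiply_sigma_local sigma n F) ->
  multiply_sigma_local sigma n (class_meet S).
Proof.
elim: n S => [|n IHn] S locS; first exact: formation_meet.
split.
  by apply: formation_meet => F /locS; apply: multiply_sigma_local_formation.
have [S1|nS1] := EM (S trivial_class).
  left; apply: subclass_antisym => G; first exact.
  by move=> G1 F /locS /trivial_sub_multiply_sigma_local; apply.
right.
pose W F (h : I -> grpclass) :=
  [/\ forall i, formation (h i), F = LF sigma h &
      forall i, sigma_of_class sigma F i -> multiply_sigma_local sigma n (h i)].
have exW F : S F -> exists h, W F h.
  by move=> SF; have [_ [F1|//]] := locS F SF; rewrite F1 in SF.
exists (fun i => class_meet (fun X => exists F h, [/\ S F, W F h & X = h i])).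
split.
- by move=> i; apply: formation_meet => _ [F [h [_ [formh _ _] ->]]].
- by apply: class_meet_LF => // F h [].
- move=> i [G SG siG]; apply: IHn => _ [F [h [SF [_ _ loch] ->]]].
  by apply: loch; exists G; first exact: SG.
Qed.

Lemma l_tau_sigma_meet (tau : group_subsets) n (S : grpclass -> Prop) :
  (forall F, S F -> l_tau_sigma sigma tau n F) ->
  l_tau_sigma sigma tau n (class_meet S).
Proof.
move=> lS; split.
  by apply: multiply_sigma_local_meet => F /lS[].
by apply: functor_closed_meet => F /lS[].
Qed.

End SigmaLocalMeet.

Theorem theorem3p1 (I : Type) (sigma : I -> nat_pred) (tau : group_subsets)
    (n : nat) (sigmaP : prime_partition sigma) (tauP : subgroup_functor tau) :
  [/\ inclusion_partial_order (l_tau_sigma sigma tau n),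
      complete_lattice_of_formations (l_tau_sigma sigma tau n) &
      forall (J : Type) (F : J -> grpclass),
        (forall j, l_tau_sigma sigma tau n (F j)) ->
        greatest_lower_bound (l_tau_sigma sigma tau n) F (class_bigcap F) /\
        least_upper_bound (l_tau_sigma sigma tau n) F
          (join_tau_sigma sigma tau n F)].
Proof.
(* The class of all groups, as an empty intersection. *)
have l_all : l_tau_sigma sigma tau n (class_meet (fun=> False)).
  exact: l_tau_sigma_meet.
split.
- split=> [F _ G //|F H _ _|F H K _ _ _ FH HK G /FH /HK//].
  exact: subclass_antisym.
- split; first by exists (class_meet (fun=> False)).
  + by move=> F [/multiply_sigma_local_formation].
  + exact: l_tau_sigma_meet.
  + by exists (class_meet (fun=> False)) => // H _ G _ F [].
move=> J F lF; split; split.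
- by rewrite class_bigcapE; apply: l_tau_sigma_meet => _ [j ->].
- by move=> j G; apply.
- by move=> H _ HF G HG j; apply: HF.
- by apply: l_tau_sigma_meet => H [].
- by move=> j G FjG H [_ FH]; apply: FH; exists j.
- by move=> H lH FH G; apply; split=> // K [j /FH].
Qed.
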